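(* Let $\mathbb{C}$ be one of $\mathbb{C}_{\mathrm{rn}},\mathbb{C}_{\mathrm{vs}},\mathbb{C}_{\mathrm{ts}}$ and let $\lhd$ be a coverage on $\mathbb{C}$ with forcing relation $\Vdash$. If $\Gamma\vdash_X\phi$, then for every condition $C$ and every environment $\rho:X\to\mathrm{Tm}(C)$, if $C\Vdash\psi\rho$ for all $\psi\in\Gamma$ then $C\Vdash\phi\rho$.
   Context: Signature $\Sigma$ single-sorted; formulas may be infinitary (small conjunctions/disjunctions, finitely many free variables) and may contain equality. Conditions $(X;A)$: $X$ finite set of variables, $A$ finite set of atoms (not equations) over $X$; $\mathrm{Tm}(C)$ is the set of terms over the variables of $C$. $\mathbb{C}_{\mathrm{ts}}$: morphisms $f:(Y;B)\to(X;A)$ are $f:X\to\mathrm{Tm}(Y)$ with $Af\subseteq B$ (postfix substitution, diagram-order composition); $\mathbb{C}_{\mathrm{vs}}$: variable-to-variable maps; $\mathbb{C}_{\mathrm{rn}}$: injective ones. A coverage on $\mathbb{C}$ is a relation $C\lhd U$ (also $U\rhd C$) between objects $C$ and sets $U$ of morphisms with codomain $C$ such that if $C\lhd U$ and $g:D\to C$ then there is $V\rhd D$ with every $g\circ h$ ($h\in V$) factoring through some member of $U$. Forcing relative to $\lhd$: $C\Vdash\top$ always; $C\Vdash\bot$ iff $C\lhd\emptyset$; atom $\psi$ iff some $U\rhd C$ with $\psi f$ among the atoms of the domain for every $f\in U$; $C\Vdash s=t$ iff some $U\rhd C$ with $sf=tf$ for all $f\in U$; $\bigwedge$ componentwise;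 $C\Vdash\bigvee_i\psi_i$ iff some $U\rhd C$ with each $f:D\to C$ in $U$ having $D\Vdash\psi_if$ for some $i$; $C\Vdash\psi_1\to\psi_2$ iff for all $f:D\to C$, $D\Vdash\psi_1f$ implies $D\Vdash\psi_2f$; $C\Vdash\forall x.\psi$ iff $D\Vdash\psi[f,x:=t]$ for all $f:D\to C$ and $t\in\mathrm{Tm}(D)$; $C\Vdash\exists x.\psi$ iff some $U\rhd C$ with each $f:D\to C$ in $U$ having $D\Vdash\psi[f,x:=t]$ for some $t\in\mathrm{Tm}(D)$. $\Gamma\vdash_X\phi$: derivability in intuitionistic natural deduction with equality, where $X$ is a set of variables containing the free variables of $\Gamma,\phi$; propositional rules as usual, including infinitary $\bigvee$-intro/elim and $\bigwedge$-intro/elim (proofs may be infinitary); quantifier rules: $\Gamma\vdash_X\forall x.\phi$ from $\Gamma\vdash_{X,x}\phi$ ($x$ not free in $\Gamma$); $\Gamma\vdash_X\exists x.\phi$ from $\Gamma\vdash_X\phi[x:=t]$ with $t\in\mathrm{Tm}(X)$; $\Gamma\vdash_X\phi[x:=t]$ from $\Gamma\vdash_X\forall x.\phi$ with $t\in\mathrm{Tm}(X)$; $\Gamma\vdash_X\phi$ from $\Gamma\vdash_X\exists x.\psi$ and $\Gamma,\psi\vdash_{X,x}\phi$ ($x$ not free in $\Gamma,\phi$).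
   Formalization: The coverage is also assumed to give every condition at least one cover and to be transitive up to refinement (covers of the members of a cover yield a cover refining the composites); with stability alone the claim fails, e.g. for the empty coverage and t = t. *)

(* Defs.v *)
From mathcomp Require Import all_boot finmap.
From mathcomp Require Import boolp classical_sets functions cardinality.

Set Implicit Arguments.
Unset Strict Implicit.
Unset Printing Implicit Defensive.

Local Open Scope classical_set_scope.

Implicit Types X Y Z J : Type.

Record signature := Signature {
  fsym : Type;
  farity : fsym -> nat;
  rsym : Type;
  rarity : rsym -> nat }.

Inductive term (S : signature) (X : Type) : Type :=
| Var (x : X)
| App (f : fsym S) (ts : 'I_(farity f) -> term S X).

Inductive atom (S : signature) (X : Type) : Type :=
| Rel (r : rsym S) (ts : 'I_(rarity r) -> term S X).

Arguments Var {S X} x.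
Arguments App {S X} f ts.
Arguments Rel {S X} r ts.

(* Raw formulas with free variables in [X].  Binders are nameless: the bound
   variable of [All psi] and [Ex psi] is [None : option X], so formulas are
   taken up to renaming of bound variables and [option X] plays the role of
   "X, x" with x fresh.  Binary conjunction and disjunction are the instances
   [J := bool] of [And] and [Or]. *)
Inductive form (S : signature) (X : Type) : Type :=
| Atom (a : atom S X)
| Eq (s t : term S X)
| Top
| Bot
| And (J : Type) (F : J -> form S X)
| Or (J : Type) (F : J -> form S X)
| Imp (p q : form S X)
| All (p : form S (option X))
| Ex (p : form S (option X)).

Arguments Top {S X}.
Arguments Bot {S X}.

Fixpoint tfv S X (t : term S X) : set X :=
  match t with
  | Var x => [set x]
  | App f ts => \bigcup_(i in setT) tfv (ts i)
  end.

Definition afv S X (a : atom S X) : set X :=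
  let: Rel r ts := a in \bigcup_(i in setT) tfv (ts i).

Fixpoint fv S X (p : form S X) : set X :=
  match p with
  | Atom a => afv a
  | Eq s t => tfv s `|` tfv t
  | Top => set0
  | Bot => set0
  | And J F => \bigcup_(i in [set: J]) fv (F i)
  | Or J F => \bigcup_(i in [set: J]) fv (F i)
  | Imp p q => fv p `|` fv q
  | All p => Some @^-1` fv p
  | Ex p => Some @^-1` fv p
  end.

(* When [X] is infinite, an infinitary connective can produce infinitely many
   free variables; such raw formulas are not formulas.  Every immediate
   subformula of a formula is again a formula. *)
Definition formula S X (p : form S X) : Prop := finite_set (fv p).

Fixpoint tsubst S X Y (t : term S X) (r : X -> term S Y) : term S Y :=
  match t with
  | Var x => r x
  | App f ts => App f (fun i => tsubst (ts i) r)
  end.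

Definition asubst S X Y (a : atom S X) (r : X -> term S Y) : atom S Y :=
  let: Rel s ts := a in Rel s (fun i => tsubst (ts i) r).

Definition extend S X Y (r : X -> term S Y) (t : term S Y) :
    option X -> term S Y :=
  fun o => if o is Some x then r x else t.

Definition lift S X Y (r : X -> term S Y) : option X -> term S (option Y) :=
  extend (fun x => tsubst (r x) (fun y => Var (Some y))) (Var None).

Fixpoint fsubst S X (p : form S X) : forall Y, (X -> term S Y) -> form S Y :=
  match p with
  | Atom a => fun Y r => Atom (asubst a r)
  | Eq s t => fun Y r => Eq (tsubst s r) (tsubst t r)
  | Top => fun Y r => Top
  | Bot => fun Y r => Bot
  | And J F => fun Y r => And (fun i => fsubst (F i) r)
  | Or J F => fun Y r => Or (fun i => fsubst (F i) r)
  | Imp p q => fun Y r => Imp (fsubst p r) (fsubst q r)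
  | All p => fun Y r => All (fsubst p (lift r))
  | Ex p => fun Y r => Ex (fsubst p (lift r))
  end.

Definition inst S X (p : form S (option X)) (t : term S X) : form S X :=
  fsubst p (extend Var t).

Definition weaken S X (p : form S X) : form S (option X) :=
  fsubst p (fun x => Var (Some x)).

(* [derives G p] is "G |-_X p", with [X] (possibly infinite) the type of the
   variables of [G] and [p].  The premises [formula _] only prevent a rule from
   introducing a raw formula with infinitely many free variables. *)
Inductive derives (S : signature) :
    forall X : Type, set (form S X) -> form S X -> Prop :=
| Assume X (G : set (form S X)) p : G p -> derives G p
| TopI X (G : set (form S X)) : derives G Top
| BotE X (G : set (form S X)) p : formula p -> derives G Bot -> derives G p
| AndI X (G : set (form S X)) J (F : J -> form S X) : formula (And F) ->
    (forall i, derives G (F i)) -> derives G (And F)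
| AndE X (G : set (form S X)) J (F : J -> form S X) i :
    derives G (And F) -> derives G (F i)
| OrI X (G : set (form S X)) J (F : J -> form S X) i : formula (Or F) ->
    derives G (F i) -> derives G (Or F)
| OrE X (G : set (form S X)) J (F : J -> form S X) p : formula p ->
    derives G (Or F) -> (forall i, derives (F i |` G) p) -> derives G p
| ImpI X (G : set (form S X)) p q : formula p ->
    derives (p |` G) q -> derives G (Imp p q)
| ImpE X (G : set (form S X)) p q :
    derives G (Imp p q) -> derives G p -> derives G q
| AllI X (G : set (form S X)) (p : form S (option X)) :
    derives [set weaken q | q in G] p -> derives G (All p)
| AllE X (G : set (form S X)) (p : form S (option X)) (t : term S X) :
    derives G (All p) -> derives G (inst p t)
| ExI X (G : set (form S X)) (p : form S (option X)) (t : term S X) :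
    formula (Ex p) -> derives G (inst p t) -> derives G (Ex p)
| ExE X (G : set (form S X)) (p : form S (option X)) (q : form S X) :
    derives G (Ex p) ->
    derives (p |` [set weaken r | r in G]) (weaken q) -> derives G q
| EqI X (G : set (form S X)) (t : term S X) : derives G (Eq t t)
| EqE X (G : set (form S X)) (p : form S (option X)) (s t : term S X) :
    formula p -> derives G (Eq s t) -> derives G (inst p s) ->
    derives G (inst p t).

(* The variables of conditions are drawn from [nat]. *)
Record cond (S : signature) := Cond {
  cvars : {fset nat};
  catoms : set (atom S cvars);
  catoms_finite : finite_set catoms }.

Arguments catoms {S} c _.

Definition Tm S (C : cond S) : Type := term S (cvars C).

Inductive category := C_rn | C_vs | C_ts.

Definition admissible S (k : category) X Y (f : X -> term S Y) : Prop :=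
  match k with
  | C_rn => exists2 g : X -> Y, injective g & f = fun x => Var (g x)
  | C_vs => exists g : X -> Y, f = fun x => Var (g x)
  | C_ts => True
  end.

(* Note the direction: [f : D --> C] is a substitution from the variables of
   [C] to the terms of [D]. *)
Record hom S (k : category) (D C : cond S) := Hom {
  hom_fun :> cvars C -> Tm D;
  hom_admissible : admissible k hom_fun;
  hom_atoms : forall a, catoms C a -> catoms D (asubst a hom_fun) }.

Lemma tsubstA S X Y Z (t : term S X) (r : X -> term S Y) (s : Y -> term S Z) :
  tsubst (tsubst t r) s = tsubst t (fun x => tsubst (r x) s).
Proof. by elim: t => //= f ts IH; congr App; apply/funext => i. Qed.

Lemma asubstA S X Y Z (a : atom S X) (r : X -> term S Y) (s : Y -> term S Z) :
  asubst (asubst a r) s = asubst a (fun x => tsubst (r x) s).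
Proof. by case: a => q ts /=; congr Rel; apply/funext => i; exact: tsubstA. Qed.

Lemma tsubst_id S X (t : term S X) : tsubst t Var = t.
Proof. by elim: t => //= f ts IH; congr App; apply/funext => i. Qed.

Lemma asubst_id S X (a : atom S X) : asubst a Var = a.
Proof. by case: a => q ts /=; congr Rel; apply/funext => i; exact: tsubst_id. Qed.

Lemma admissible_id S k X : admissible k (Var : X -> term S X).
Proof.
case: k => //=; first by exists id.
by exists id.
Qed.

Lemma admissible_comp S k X Y Z (f : X -> term S Y) (g : Y -> term S Z) :
  admissible k f -> admissible k g -> admissible k (fun x => tsubst (f x) g).
Proof.
case: k => //=.
- by move=> [u uI ->] [v vI ->]; exists (v \o u) => //; exact: inj_comp.
- by move=> [u ->] [v ->]; exists (v \o u).
Qed.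

Lemma hom_id_atoms S (C : cond S) a : catoms C a -> catoms C (asubst a Var).
Proof. by rewrite asubst_id. Qed.

Definition hom_id S k (C : cond S) : hom k C C :=
  Hom (admissible_id S k (cvars C)) (@hom_id_atoms S C).

Lemma hom_comp_atoms S k (E D C : cond S) (g : hom k D C) (h : hom k E D) a :
  catoms C a -> catoms E (asubst a (fun x => tsubst (g x) h)).
Proof. by move=> Ca; rewrite -asubstA; do 2! apply: hom_atoms. Qed.

(* The composite E --h--> D --g--> C. *)
Definition hom_comp S k (E D C : cond S) (g : hom k D C) (h : hom k E D) :
    hom k E C :=
  Hom (admissible_comp (hom_admissible g) (hom_admissible h))
      (@hom_comp_atoms S k E D C g h).

Definition sink S k (C : cond S) : Type := forall D : cond S, set (hom k D C).

Definition factors S k (E C : cond S) (l : hom k E C) (U : sink k C) : Prop :=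
  exists D (f : hom k D C) (h : hom k E D), U D f /\ l = hom_comp f h.

Definition is_coverage S k (cov : forall C : cond S, sink k C -> Prop) : Prop :=
  forall C (U : sink k C), cov C U ->
  forall D (g : hom k D C), exists2 V : sink k D, cov D V &
    forall E (h : hom k E D), V E h -> factors (hom_comp g h) U.

(* The next two conditions are weak forms of two standard axioms on Grothendieck
   pretopologies, "the identity of C covers C" and transitivity.  Stability
   alone gives neither [C ||- t = t] (consider the empty coverage) nor local
   character of forcing. *)
Definition cov_inhabited S k (cov : forall C : cond S, sink k C -> Prop) : Prop :=
  forall C, exists U : sink k C, cov C U.

(* The usual axiom asks that the set of all composites [hom_comp f g], with
   [U D f] and [V D f E' g], cover [C]; here a refinement of it has to. *)
Definition cov_transitive S k (cov : forall C : cond S, sink k C -> Prop) : Prop :=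
  forall C (U : sink k C) (V : forall D, hom k D C -> sink k D),
  cov C U -> (forall D (f : hom k D C), U D f -> cov D (V D f)) ->
  exists2 W : sink k C, cov C W &
    forall E (l : hom k E C), W E l ->
      exists D (f : hom k D C), U D f /\
        exists E' (g : hom k E' D) (h : hom k E E'),
          V D f E' g /\ l = hom_comp (hom_comp f g) h.

(* Forcing of [p] under the substitution [r], by recursion on [p]; see
   [forces] below and the lemmas [forces_*] for the forcing clauses. *)
Fixpoint forces_env S k (cov : forall C : cond S, sink k C -> Prop)
    X (p : form S X) : forall C : cond S, (X -> Tm C) -> Prop :=
  match p with
  | Atom a => fun C r => exists2 U : sink k C, cov C U &
      forall D (f : hom k D C), U D f -> catoms D (asubst (asubst a r) f)
  | Eq s t => fun C r => exists2 U : sink k C, cov C U &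
      forall D (f : hom k D C), U D f ->
        tsubst (tsubst s r) f = tsubst (tsubst t r) f
  | Top => fun C r => True
  | Bot => fun C r => cov C (fun D => set0)
  | And J F => fun C r => forall i, forces_env cov (F i) r
  | Or J F => fun C r => exists2 U : sink k C, cov C U &
      forall D (f : hom k D C), U D f ->
        exists i, forces_env cov (F i) (fun x => tsubst (r x) f)
  | Imp p q => fun C r => forall D (f : hom k D C),
      forces_env cov p (fun x => tsubst (r x) f) ->
      forces_env cov q (fun x => tsubst (r x) f)
  | All p => fun C r => forall D (f : hom k D C) (t : Tm D),
      forces_env cov p (extend (fun x => tsubst (r x) f) t)
  | Ex p => fun C r => exists2 U : sink k C, cov C U &
      forall D (f : hom k D C), U D f ->
        exists t : Tm D, forces_env cov p (extend (fun x => tsubst (r x) f) t)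
  end.

Definition forces S k (cov : forall C : cond S, sink k C -> Prop)
    (C : cond S) (p : form S (cvars C)) : Prop :=
  forces_env cov p (Var : cvars C -> Tm C).

Lemma extend_comp S X Y Z (r : X -> term S Y) (t : term S Y) (s : Y -> term S Z) :
  (fun o => tsubst (extend r t o) s) =
  extend (fun x => tsubst (r x) s) (tsubst t s).
Proof. by apply/funext => -[]. Qed.

Lemma lift_extend S X Y Z (r : X -> term S Y) (s : Y -> term S Z) (t : term S Z) :
  (fun o => tsubst (lift r o) (extend s t)) =
  extend (fun x => tsubst (r x) s) t.
Proof. by apply/funext => -[x|] //=; rewrite tsubstA. Qed.

Lemma tsubst_funA S X Y Z T (u : X -> term S Y) (v : Y -> term S Z)
    (w : Z -> term S T) :
  (fun x => tsubst (tsubst (u x) v) w) =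
  (fun x => tsubst (u x) (fun y => tsubst (v y) w)).
Proof. by apply/funext => x; rewrite tsubstA. Qed.

Lemma forces_env_subst S k (cov : forall C : cond S, sink k C -> Prop)
    X (p : form S X) Y (s : X -> term S Y) (C : cond S) (r : Y -> Tm C) :
  forces_env cov (fsubst p s) r <->
  forces_env cov p (fun x => tsubst (s x) r).
Proof.
elim: p Y s C r => {X}
  [X a|X t u|X|X|X J F IH|X J F IH|X p IHp q IHq|X p IH|X p IH] Y s C r //=.
- by rewrite asubstA.
- by rewrite !tsubstA.
- by split=> H i; move: (H i); rewrite IH.
- by split=> -[U CU H]; exists U => // D f /H [i Hi]; exists i;
    move: Hi; rewrite IH tsubst_funA.
- by split=> H D f; move: (H D f); rewrite IHp IHq tsubst_funA.
- by split=> H D f t; move: (H D f t); rewrite IH lift_extend tsubst_funA.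
- by split=> -[U CU H]; exists U => // D f /H [t Ht]; exists t;
    move: Ht; rewrite IH lift_extend tsubst_funA.
Qed.

Lemma forces_subst S k (cov : forall C : cond S, sink k C -> Prop)
    X (p : form S X) (C : cond S) (r : X -> Tm C) :
  forces cov (fsubst p r) <-> forces_env cov p r.
Proof.
rewrite /forces forces_env_subst.
by rewrite (_ : (fun x => tsubst (r x) Var) = r) //; apply/funext => x; rewrite tsubst_id.
Qed.

Section ForcingClauses.
Variables (S : signature) (k : category).
Variable cov : forall C : cond S, sink k C -> Prop.
Variable C : cond S.
Implicit Types p q : form S (cvars C).

Lemma forces_atom (a : atom S (cvars C)) :
  forces cov (Atom a) <-> exists2 U : sink k C, cov U &
    forall D (f : hom k D C), U D f -> catoms D (asubst a f).
Proof. by rewrite /forces /= asubst_id. Qed.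

Lemma forces_eq (s t : Tm C) :
  forces cov (Eq s t) <-> exists2 U : sink k C, cov U &
    forall D (f : hom k D C), U D f -> tsubst s f = tsubst t f.
Proof. by rewrite /forces /= !tsubst_id. Qed.

Lemma forces_top : forces cov (Top : form S (cvars C)) <-> True.
Proof. by []. Qed.

Lemma forces_bot :
  forces cov (Bot : form S (cvars C)) <-> cov (fun D => set0 : set (hom k D C)).
Proof. by []. Qed.

Lemma forces_and J (F : J -> form S (cvars C)) :
  forces cov (And F) <-> forall i, forces cov (F i).
Proof. by []. Qed.

Lemma forces_or J (F : J -> form S (cvars C)) :
  forces cov (Or F) <-> exists2 U : sink k C, cov U &
    forall D (f : hom k D C), U D f -> exists i, forces cov (fsubst (F i) f).
Proof.
by split=> -[U CU H]; exists U => // D f /H [i Hi]; exists i;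
  move: Hi; rewrite forces_subst.
Qed.

Lemma forces_imp p q :
  forces cov (Imp p q) <-> forall D (f : hom k D C),
    forces cov (fsubst p f) -> forces cov (fsubst q f).
Proof. by split=> H D f; move: (H D f); rewrite !forces_subst. Qed.

Lemma forces_all (p : form S (option (cvars C))) :
  forces cov (All p) <-> forall D (f : hom k D C) (t : Tm D),
    forces cov (fsubst p (extend f t)).
Proof. by split=> H D f t; move: (H D f t); rewrite forces_subst. Qed.

Lemma forces_ex (p : form S (option (cvars C))) :
  forces cov (Ex p) <-> exists2 U : sink k C, cov U &
    forall D (f : hom k D C), U D f ->
      exists t : Tm D, forces cov (fsubst p (extend f t)).
Proof.
by split=> -[U CU H]; exists U => // D f /H [t Ht]; exists t;
  move: Ht; rewrite forces_subst.
Qed.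

End ForcingClauses.

(* Main.v *)
Require Import Defs.
From mathcomp Require Import all_boot finmap.
From mathcomp Require Import boolp classical_sets functions cardinality.

(** Every clause of forcing that mentions a cover says that a property of
    morphisms, closed under precomposition, holds locally.  Stability of the
    coverage lets such statements be pulled back, so forcing is monotone;
    transitivity makes "locally locally" the same as "locally", so forcing has
    local character.  With these two facts each rule of natural deduction is
    sound, by induction on derivations. *)

Set Implicit Arguments.
Unset Strict Implicit.
Unset Printing Implicit Defensive.

Local Open Scope classical_set_scope.

Lemma tsubst_fun_id S X Y (r : X -> term S Y) :
  (fun x => tsubst (r x) Var) = r.
Proof. by apply/funext => x; exact: tsubst_id. Qed.

Section Soundness.
Variables (S : signature) (k : category).
Variable cov : forall C : cond S, sink k C -> Prop.
Hypothesis cov_stable : is_coverage cov.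
Hypothesis cov_inh : cov_inhabited cov.
Hypothesis cov_trans : cov_transitive cov.

(** The clauses of [forces_env] for atoms, equations, [Or] and [Ex] are instances of this by
    conversion. *)
Definition locally (C : cond S) (P : forall D, hom k D C -> Prop) : Prop :=
  exists2 U : sink k C, cov U & forall D (f : hom k D C), U D f -> P D f.

Definition sieve (C : cond S) (P : forall D, hom k D C -> Prop) : Prop :=
  forall D (f : hom k D C) E (g : hom k E D), P D f -> P E (hom_comp f g).

Lemma locally_impl (C : cond S) (P Q : forall D, hom k D C -> Prop) :
  (forall D f, P D f -> Q D f) -> locally P -> locally Q.
Proof. by move=> PQ [U CU UP]; exists U => // D f /UP /PQ. Qed.

Lemma locally_all (C : cond S) (P : forall D, hom k D C -> Prop) :
  (forall D f, P D f) -> locally P.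
Proof. by move=> HP; have [U CU] := cov_inh C; exists U. Qed.

(** Stability yields a cover of [D] whose composites with [g] merely factor through members of [U];
    being a sieve carries [P] along the factorization. *)
Lemma locally_pullback (C D : cond S) (P : forall D, hom k D C -> Prop)
    (g : hom k D C) :
  sieve P -> locally P -> locally (fun E (h : hom k E D) => P E (hom_comp g h)).
Proof.
move=> sP [U CU UP]; have [V DV VU] := cov_stable CU g.
exists V => // E h /VU [D' [f [h' [Uf ->]]]].
by apply: sP; exact: UP.
Qed.

Lemma locally_trans (C : cond S) (P : forall D, hom k D C -> Prop) :
  sieve P ->
  locally (fun D (f : hom k D C) =>
    locally (fun E (g : hom k E D) => P E (hom_comp f g))) ->
  locally P.
Proof.
move=> sP [U CU UP].
(* [cov_trans] takes a family of sinks indexed by all morphisms into [C], so covers are chosen for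
   all pairs [(D, f)] at once; when [f] is not in [U] the empty sink is a harmless default. *)
have exV : forall Df : {D : cond S & hom k D C},
    exists V : sink k (projT1 Df), U (projT1 Df) (projT2 Df) ->
      cov V /\ forall E (g : hom k E (projT1 Df)),
        V E g -> P E (hom_comp (projT2 Df) g).
  move=> [D f] /=; have [Uf|nUf] := pselect (U D f); last first.
    by exists (fun D => set0) => /nUf.
  by have [V DV VP] := UP D f Uf; exists V.
pose V Df := projT1 (cid (exV Df)); have HV Df := projT2 (cid (exV Df)).
have [|W CW HW] := cov_trans (V := fun D f => V (existT _ D f)) CU.
  by move=> D f Uf; case: (HV (existT _ D f) Uf).
exists W => // E l /HW [D [f [Uf [E' [g [h [Vg ->]]]]]]].
by apply: sP; exact: (proj2 (HV (existT _ D f) Uf)).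
Qed.

(** A sink whose members all satisfy [False] is the empty sink by extensionality. This brings the
    clause for [Bot] under [locally]. *)
Lemma cov_set0P (C : cond S) :
  cov (fun D => set0 : set (hom k D C)) <->
  locally (fun D (_ : hom k D C) => False).
Proof.
split=> [C0|[U CU U0]]; first by exists (fun D => set0).
rewrite (_ : (fun D => set0) = U) //; apply: functional_extensionality_dep => D.
by apply/seteqP; split=> [f []|f /U0].
Qed.

(** Clauses with a cover are pulled back along [f]; for [Or] and [Ex] the induction hypothesis shows
    that the predicate is a sieve. [Imp] and [All] already range over all morphisms, so composing
    with [f] suffices. *)
Lemma forces_env_hom X (p : form S X) (C : cond S) (r : X -> Tm C)
    D (f : hom k D C) :
  forces_env cov p r -> forces_env cov p (fun x => tsubst (r x) f).
Proof.
elim: p C r D f => {X}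
  [X a|X t u|X|X|X J F IH|X J F IH|X p IHp q IHq|X p IH|X p IH] C r D f //=.
- set P := fun D (f : hom k D C) => catoms D (asubst (asubst a r) f).
  have sP : sieve P.
    by move=> E g E' h /(hom_atoms h); rewrite /P asubstA.
  move=> /(locally_pullback f sP); apply: locally_impl => E g.
  by rewrite /P /= !asubstA tsubst_funA.
- set P := fun D (f : hom k D C) =>
    tsubst (tsubst t r) f = tsubst (tsubst u r) f.
  have sP : sieve P.
    by move=> E g E' h Pg; rewrite /P -!tsubstA Pg.
  move=> /(locally_pullback f sP); apply: locally_impl => E g.
  by rewrite /P /= !tsubstA tsubst_funA.
- move=> /cov_set0P C0; apply/cov_set0P.
  by apply: (locally_pullback f _ C0).
- by move=> H i; exact: IH.
- set P := fun D (f : hom k D C) =>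
    exists i, forces_env cov (F i) (fun x => tsubst (r x) f).
  have sP : sieve P.
    move=> E g E' h [i Pi]; exists i.
    by rewrite /= -tsubst_funA; exact: IH.
  move=> /(locally_pullback f sP); apply: locally_impl => E g [i Pi].
  by exists i; rewrite tsubst_funA.
- by move=> H E g; rewrite tsubst_funA; exact: (H E (hom_comp f g)).
- by move=> H E g t; rewrite tsubst_funA; exact: (H E (hom_comp f g)).
- set P := fun D (f : hom k D C) =>
    exists t : Tm D, forces_env cov p (extend (fun x => tsubst (r x) f) t).
  have sP : sieve P.
    move=> E g E' h [t Pt]; exists (tsubst t h).
    by rewrite /= -tsubst_funA -extend_comp; exact: IH.
  move=> /(locally_pullback f sP); apply: locally_impl => E g [t Pt].
  by exists t; rewrite tsubst_funA.
Qed.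

Lemma sieve_forces_env X (p : form S X) (C : cond S) (r : X -> Tm C) :
  sieve (fun D (f : hom k D C) => forces_env cov p (fun x => tsubst (r x) f)).
Proof.
by move=> D f E g /(forces_env_hom g); rewrite /= tsubst_funA.
Qed.

(** Clauses with a cover collapse two layers of [locally] into one. For [Imp] and [All] the
    hypothesis is pulled back along the given morphism, and the induction hypothesis applies
    there. *)
Lemma forces_env_local X (p : form S X) (C : cond S) (r : X -> Tm C) :
  locally (fun D (f : hom k D C) =>
    forces_env cov p (fun x => tsubst (r x) f)) ->
  forces_env cov p r.
Proof.
elim: p C r => {X}
  [X a|X t u|X|X|X J F IH|X J F IH|X p IHp q IHq|X p IH|X p IH] C r //= H.
- apply: locally_trans => [D f E g /(hom_atoms g)|]; first by rewrite asubstA.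
  apply: locally_impl H => D f; apply: locally_impl => E g.
  by rewrite /= !asubstA tsubst_funA.
- apply: locally_trans => [D f E g Pf|]; first by rewrite -!tsubstA Pf.
  apply: locally_impl H => D f; apply: locally_impl => E g.
  by rewrite /= !tsubstA tsubst_funA.
- apply/cov_set0P; apply: locally_trans => //.
  by apply: locally_impl H => D f /cov_set0P.
- by move=> i; apply: IH; apply: locally_impl H => D f; exact.
- apply: locally_trans => [D f E g [i Pi]|].
    by exists i; move: Pi => /(forces_env_hom g); rewrite /= tsubst_funA.
  apply: locally_impl H => D f; apply: locally_impl => E g [i].
  by rewrite tsubst_funA; exists i.
- move=> D g pg; apply: IHq.
  have := locally_pullback g (@sieve_forces_env _ (Imp p q) C r) H.
  (* The implication forced at [E] is used at the identity, once the antecedent has been transported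
     along [h]. *)
  apply: locally_impl => E h /(_ E (hom_id k E)) /=.
  rewrite !tsubst_fun_id tsubst_funA.
  by apply; have := forces_env_hom h pg; rewrite tsubst_funA.
- move=> D g t; apply: IH.
  have := locally_pullback g (@sieve_forces_env _ (All p) C r) H.
  apply: locally_impl => E h /(_ E (hom_id k E) (tsubst t h)) /=.
  by rewrite extend_comp tsubst_fun_id tsubst_funA.
- apply: locally_trans => [D f E g [t Pt]|].
    exists (tsubst t g); move: Pt => /(forces_env_hom g).
    by rewrite extend_comp tsubst_funA.
  apply: locally_impl H => D f; apply: locally_impl => E g [t].
  by rewrite tsubst_funA; exists t.
Qed.

Lemma forces_env_inst X (p : form S (option X)) (t : term S X) (C : cond S)
    (r : X -> Tm C) :
  forces_env cov (inst p t) r <-> forces_env cov p (extend r (tsubst t r)).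
Proof. by rewrite forces_env_subst extend_comp. Qed.

Lemma forces_env_weaken X (p : form S X) (C : cond S) (r : X -> Tm C) (t : Tm C) :
  forces_env cov (weaken p) (extend r t) <-> forces_env cov p r.
Proof. by rewrite forces_env_subst. Qed.

(** Condition and environment stay universal, since the binder rules change both. The eliminations
    of [Bot], [Or], [Ex] and equality establish the conclusion on a cover and end by local
    character; the introductions of [Or], [Ex] and equality need only some cover. *)
Lemma soundness X (G : set (form S X)) (p : form S X) :
  derives G p -> forall (C : cond S) (r : X -> Tm C),
  (forall q, G q -> forces_env cov q r) -> forces_env cov p r.
Proof.
elim=> {X G p}.
- by move=> X G p Gp C r; apply.
- by [].
- move=> X G p _ _ IH C r /IH /cov_set0P C0; apply: forces_env_local.
  exact: locally_impl C0.
- by move=> X G J F _ _ IH C r Gr i; exact: IH.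
- by move=> X G J F i _ IH C r /IH; exact.
- move=> X G J F i _ _ IH C r /IH Fi; apply: locally_all => D f.
  by exists i; exact: forces_env_hom.
- move=> X G J F p _ _ IHO _ IH C r Gr; apply: forces_env_local.
  apply: locally_impl (IHO C r Gr) => D f [i Fi]; apply: (IH i) => q [->//|Gq].
  by apply: forces_env_hom; exact: Gr.
- move=> X G p q _ _ IH C r Gr D f pf; apply: IH => s [->//|Gs].
  by apply: forces_env_hom; exact: Gr.
- move=> X G p q _ IHpq _ IHp C r Gr.
  have := IHpq C r Gr C (hom_id k C); rewrite tsubst_fun_id; apply.
  exact: IHp.
- move=> X G p _ IH C r Gr D f t; apply: IH => _ [q Gq <-].
  by apply/forces_env_weaken; apply: forces_env_hom; exact: Gr.
- move=> X G p t _ IH C r Gr; apply/forces_env_inst.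
  by have := IH C r Gr C (hom_id k C) (tsubst t r); rewrite tsubst_fun_id.
- move=> X G p t _ _ IH C r /IH /forces_env_inst pt; apply: locally_all => D f.
  exists (tsubst (tsubst t r) f).
  by rewrite -extend_comp; exact: forces_env_hom.
- move=> X G p q _ IHE _ IH C r Gr; apply: forces_env_local.
  apply: locally_impl (IHE C r Gr) => D f [t pt].
  (* As [q] does not mention the bound variable, its environment may be extended by the local
     witness [t], which makes the premise under the binder applicable. *)
  apply/(forces_env_weaken q _ t); apply: IH => _ [->//|[s Gs <-]].
  by apply/forces_env_weaken; apply: forces_env_hom; exact: Gr.
- by move=> X G t C r _; exact: locally_all.
- move=> X G p s t _ _ IHst _ IH C r Gr; apply: forces_env_local.
  apply: locally_impl (IHst C r Gr) => D f Est.
  (* After [f] the values of [s] and [t] coincide by [Est], so both instances of [p] are read in the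
     same extended environment. *)
  have := forces_env_hom f (IH C r Gr).
  by rewrite !forces_env_inst -!tsubstA Est.
Qed.

End Soundness.

Theorem theorem5p5 (S : signature) (k : category)
    (cov : forall C : cond S, sink k C -> Prop)
    (cov_stable : is_coverage cov)
    (cov_inh : cov_inhabited cov)
    (cov_trans : cov_transitive cov)
    (X : Type) (G : set (form S X)) (p : form S X)
    (G_formulas : forall q, G q -> formula q)
    (G_derives_p : derives G p)
    (C : cond S) (rho : X -> Tm C) :
  (forall q, G q -> forces cov (fsubst q rho)) -> forces cov (fsubst p rho).
Proof.
move=> Grho; apply/forces_subst; apply: (soundness _ _ _ G_derives_p) => //.
by move=> q /Grho /forces_subst.
Qed.
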